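(* Let $t,t'$ be both $\lambda\mu$-terms or both $\lambda\mu$-commands. If $t\to_v t'$ in one call-by-value step in the $\lambda\mu$-calculus, then there exists an expression $u$ of $\bar\lambda\mu\tilde\mu_Q$ such that $t^\dag\overset{*}{\to}_v u$ and $t'^\dag\overset{*}{\leadsto}_v u$.
   Context: Throughout, $x,y,\dots$ range over $\lambda$-variables and $\alpha,\beta,\delta,\dots$ over $\mu$-variables; $\lambda,\mu,\tilde\mu$ are binders, expressions are identified up to $\alpha$-equivalence and all substitutions are capture-avoiding. All one-step reductions may be applied to any subexpression (compatible closure of the displayed rules). **$\lambda\mu$-calculus.** Terms $t ::= x \mid \lambda x.t \mid (t)\,t \mid \mu\alpha.c$; values $v ::= x\mid\lambda x.t$; commands $c ::= [\alpha]\,t$; contexts $e ::= \alpha \mid \beta(t) \mid t\cdot e$ (in $\beta(t)$, $\beta$ is any $\mu$-variable). For a context $e$ and term $t$ the command $e\{t\}$ is: $\alpha\{t\}=[\alpha]\,t$; $\beta(u)\{t\}=[\beta]\,(u)\,t$; $(u\cdot h)\{t\}=h\{(t)\,u\}$. For a $\mu$-variable $\alpha$ and context $e$, $t[\alpha\gets e]$ and $c[\alpha\gets e]$ are defined by structural recursion, commuting with all constructors except $([\alpha]\,t)[\alpha\gets e]=e\{t[\alpha\gets e]\}$ (and $([\beta]\,t)[\alpha\gets e]=[\beta]\,t[\alpha\gets e]$ for $\beta\neq\alpha$). Call-by-value one-step reduction $\to_v$ is given by the rules (with $v$ a value, $t$ any term, and bound $\alpha$ chosen not free in $v$, $t$ in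 $\mu_v$, $\mu'$): - $\beta_v$: $(\lambda x.u)\,v\to u[x\gets v]$; - $\mu_v$: $(\mu\alpha.c)\,v\to\mu\alpha.\,c[\alpha\gets v\cdot\alpha]$; - $\mu'$: $(t)\,\mu\alpha.c\to\mu\alpha.\,c[\alpha\gets\alpha(t)]$; - $\rho$: $[\beta]\,\mu\alpha.c\to c[\alpha\gets\beta]$; - $\theta$: $\mu\delta.[\delta]\,t\to t$ if $\delta$ is not free in $t$. **Call-by-value calculus $\bar\lambda\mu\tilde\mu_Q$.** Terms $t ::= x\mid\lambda x.t\mid\mu\alpha.c$; values $v ::= x\mid\lambda x.t$; commands $c ::= \langle t\,|\,e\rangle$; contexts $e ::= \alpha\mid v\cdot e\mid\tilde\mu x.c$. Call-by-value rules: - $\beta$: $\langle\lambda x.u\,|\,v\cdot e\rangle\to\langle v\,|\,\tilde\mu x.\langle u\,|\,e\rangle\rangle$; - $\mu$: $\langle\mu\alpha.c\,|\,e\rangle\to c[\alpha\gets e]$; - $\tilde\mu_v$: $\langle v\,|\,\tilde\mu x.c\rangle\to c[x\gets v]$ for $v$ a value; - $\theta$: $\mu\delta.\langle t\,|\,\delta\rangle\to t$ if $\delta$ is not free in $t$. $\overset{*}{\to}_v$ is the reflexive-transitive closure of the union of these. A step is linear if it is a $\beta$-step, a $\theta$-step, a $\mu$-step in which $e$ is a $\mu$-variable or $\alpha$ has exactly one free occurrence in $c$, or a $\tilde\mu_v$-step in which $v$ is a $\lambda$-variable or $x$ has exactly one free occurrence in $c$. $\overset{*}{\leadsto}_v$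 is the reflexive-transitive closure of linear call-by-value one-step reduction. **Translation $(\cdot)^\dag$.** $x^\dag=x$; $(\lambda x.u)^\dag=\lambda x.u^\dag$; $((u)\,w)^\dag=\mu\beta.\langle w^\dag\,|\,\tilde\mu y.\langle u^\dag\,|\,y\cdot\beta\rangle\rangle$ with $y,\beta$ not free in $u,w$; $(\mu\alpha.c)^\dag=\mu\alpha.c^\dag$; $([\alpha]\,t)^\dag=\langle t^\dag\,|\,\alpha\rangle$. *)

(* Defs.v *)
From Stdlib Require Import Relations.

(** Expressions up to alpha-equivalence are represented with de Bruijn indices.
    lambda-variables and mu-variables are indexed independently: [Lam] and the
    mu-tilde binder bind lambda-index 0, [Mu] binds mu-index 0.  Renamings and
    substitutions are parallel and act on both kinds of variables at once. *)

Definition scons {A : Type} (a : A) (f : nat -> A) (n : nat) : A :=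
  match n with
  | O => a
  | S m => f m
  end.

Infix ".:" := scons (at level 60, right associativity).

Definition idr (n : nat) : nat := n.

Definition upr (f : nat -> nat) : nat -> nat := 0 .: (fun n => S (f n)).

Module LM.

Inductive tm : Type :=
| Var (x : nat)
| Lam (t : tm)
| App (t u : tm)
| Mu (c : cmd)
with cmd : Type :=
| Name (a : nat) (t : tm).

Inductive value : tm -> Prop :=
| value_var x : value (Var x)
| value_lam t : value (Lam t).

(** [CFun b t] is the context b(t), [CArg t e] the context t . e. *)
Inductive ctx : Type :=
| CVar (a : nat)
| CFun (b : nat) (t : tm)
| CArg (t : tm) (e : ctx).

Fixpoint fill (e : ctx) (t : tm) : cmd :=
  match e with
  | CVar a => Name a t
  | CFun b u => Name b (App u t)
  | CArg u h => fill h (App t u)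
  end.

Fixpoint ren (f g : nat -> nat) (t : tm) : tm :=
  match t with
  | Var x => Var (f x)
  | Lam t => Lam (ren (upr f) g t)
  | App t u => App (ren f g t) (ren f g u)
  | Mu c => Mu (ren_cmd f (upr g) c)
  end
with ren_cmd (f g : nat -> nat) (c : cmd) : cmd :=
  match c with
  | Name a t => Name (g a) (ren f g t)
  end.

Fixpoint ren_ctx (f g : nat -> nat) (e : ctx) : ctx :=
  match e with
  | CVar a => CVar (g a)
  | CFun b t => CFun (g b) (ren f g t)
  | CArg t e => CArg (ren f g t) (ren_ctx f g e)
  end.

(** Simultaneous capture-avoiding substitution of the terms [s x] for the
    lambda-variables x and structural substitution of the contexts [k a] for
    the mu-variables a.  A mu-variable b is left alone by [k b = CVar b], since
    [fill (CVar b) t = Name b t]. *)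
Fixpoint subst (s : nat -> tm) (k : nat -> ctx) (t : tm) : tm :=
  match t with
  | Var x => s x
  | Lam t => Lam (subst (Var 0 .: (fun x => ren S idr (s x)))
                        (fun a => ren_ctx S idr (k a)) t)
  | App t u => App (subst s k t) (subst s k u)
  | Mu c => Mu (subst_cmd (fun x => ren idr S (s x))
                          (CVar 0 .: (fun a => ren_ctx idr S (k a))) c)
  end
with subst_cmd (s : nat -> tm) (k : nat -> ctx) (c : cmd) : cmd :=
  match c with
  | Name a t => fill (k a) (subst s k t)
  end.

(** In [step_mu] and [step_mu'] the bound variable is bound again in the
    reduct, hence index 0 is replaced by a context mentioning index 0 and
    the other indices are kept.  In [step_theta], a term in which mu-index 0 is
    not free is one of the form [ren idr S t]. *)
Inductive step : tm -> tm -> Prop :=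
| step_beta u v :
    value v ->
    step (App (Lam u) v) (subst (v .: Var) CVar u)
| step_mu c v :
    value v ->
    step (App (Mu c) v)
         (Mu (subst_cmd Var
                (CArg (ren idr S v) (CVar 0) .: (fun a => CVar (S a))) c))
| step_mu' t c :
    step (App t (Mu c))
         (Mu (subst_cmd Var
                (CFun 0 (ren idr S t) .: (fun a => CVar (S a))) c))
| step_theta t :
    step (Mu (Name 0 (ren idr S t))) t
| step_lam t t' : step t t' -> step (Lam t) (Lam t')
| step_app_l t t' u : step t t' -> step (App t u) (App t' u)
| step_app_r t u u' : step u u' -> step (App t u) (App t u')
| step_mu_body c c' : step_cmd c c' -> step (Mu c) (Mu c')
with step_cmd : cmd -> cmd -> Prop :=
| step_rho b c :
    step_cmd (Name b (Mu c)) (subst_cmd Var (CVar b .: CVar) c)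
| step_name a t t' : step t t' -> step_cmd (Name a t) (Name a t').

End LM.

Module LQ.

(** Values form a syntactic class of their own, included in terms by [Val], so
    that the stack constructor [Stk] (v . e) only accepts values.  [MuT] is the
    mu-tilde binder. *)
Inductive tm : Type :=
| Val (v : val)
| Mu (c : cmd)
with val : Type :=
| Var (x : nat)
| Lam (t : tm)
with cmd : Type :=
| Cut (t : tm) (e : ctx)
with ctx : Type :=
| CVar (a : nat)
| Stk (v : val) (e : ctx)
| MuT (c : cmd).

Fixpoint ren (f g : nat -> nat) (t : tm) : tm :=
  match t with
  | Val v => Val (ren_val f g v)
  | Mu c => Mu (ren_cmd f (upr g) c)
  end
with ren_val (f g : nat -> nat) (v : val) : val :=
  match v with
  | Var x => Var (f x)
  | Lam t => Lam (ren (upr f) g t)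
  end
with ren_cmd (f g : nat -> nat) (c : cmd) : cmd :=
  match c with
  | Cut t e => Cut (ren f g t) (ren_ctx f g e)
  end
with ren_ctx (f g : nat -> nat) (e : ctx) : ctx :=
  match e with
  | CVar a => CVar (g a)
  | Stk v e => Stk (ren_val f g v) (ren_ctx f g e)
  | MuT c => MuT (ren_cmd (upr f) g c)
  end.

Definition up_val (s : nat -> val) : nat -> val :=
  Var 0 .: (fun x => ren_val S idr (s x)).

Fixpoint subst (s : nat -> val) (k : nat -> ctx) (t : tm) : tm :=
  match t with
  | Val v => Val (subst_val s k v)
  | Mu c => Mu (subst_cmd (fun x => ren_val idr S (s x))
                          (CVar 0 .: (fun a => ren_ctx idr S (k a))) c)
  end
with subst_val (s : nat -> val) (k : nat -> ctx) (v : val) : val :=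
  match v with
  | Var x => s x
  | Lam t => Lam (subst (up_val s) (fun a => ren_ctx S idr (k a)) t)
  end
with subst_cmd (s : nat -> val) (k : nat -> ctx) (c : cmd) : cmd :=
  match c with
  | Cut t e => Cut (subst s k t) (subst_ctx s k e)
  end
with subst_ctx (s : nat -> val) (k : nat -> ctx) (e : ctx) : ctx :=
  match e with
  | CVar a => k a
  | Stk v e => Stk (subst_val s k v) (subst_ctx s k e)
  | MuT c => MuT (subst_cmd (up_val s) (fun a => ren_ctx S idr (k a)) c)
  end.

(** Number of free occurrences of the lambda-variable [x]. *)
Fixpoint occ (x : nat) (t : tm) : nat :=
  match t with
  | Val v => occ_val x v
  | Mu c => occ_cmd x c
  end
with occ_val (x : nat) (v : val) : nat :=
  match v with
  | Var y => if Nat.eqb x y then 1 else 0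
  | Lam t => occ (S x) t
  end
with occ_cmd (x : nat) (c : cmd) : nat :=
  match c with
  | Cut t e => occ x t + occ_ctx x e
  end
with occ_ctx (x : nat) (e : ctx) : nat :=
  match e with
  | CVar _ => 0
  | Stk v e => occ_val x v + occ_ctx x e
  | MuT c => occ_cmd (S x) c
  end.

(** Number of free occurrences of the mu-variable [a]. *)
Fixpoint mocc (a : nat) (t : tm) : nat :=
  match t with
  | Val v => mocc_val a v
  | Mu c => mocc_cmd (S a) c
  end
with mocc_val (a : nat) (v : val) : nat :=
  match v with
  | Var _ => 0
  | Lam t => mocc a t
  end
with mocc_cmd (a : nat) (c : cmd) : nat :=
  match c with
  | Cut t e => mocc a t + mocc_ctx a e
  end
with mocc_ctx (a : nat) (e : ctx) : nat :=
  match e with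
  | CVar b => if Nat.eqb a b then 1 else 0
  | Stk v e => mocc_val a v + mocc_ctx a e
  | MuT c => mocc_cmd a c
  end.

(** A term in which mu-index 0 is not free is one of the form [ren idr S t]. *)
Inductive root : tm -> tm -> Prop :=
| root_theta t : root (Mu (Cut (ren idr S t) (CVar 0))) t.

Inductive root_cmd : cmd -> cmd -> Prop :=
| root_beta u v e :
    root_cmd (Cut (Val (Lam u)) (Stk v e))
             (Cut (Val v) (MuT (Cut u (ren_ctx S idr e))))
| root_mu c e :
    root_cmd (Cut (Mu c) e) (subst_cmd Var (e .: CVar) c)
| root_mut v c :
    root_cmd (Cut (Val v) (MuT c)) (subst_cmd (v .: Var) CVar c).

Inductive lroot_cmd : cmd -> cmd -> Prop :=
| lroot_beta u v e :
    lroot_cmd (Cut (Val (Lam u)) (Stk v e))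
              (Cut (Val v) (MuT (Cut u (ren_ctx S idr e))))
| lroot_mu c e :
    (exists a, e = CVar a) \/ mocc_cmd 0 c = 1 ->
    lroot_cmd (Cut (Mu c) e) (subst_cmd Var (e .: CVar) c)
| lroot_mut v c :
    (exists x, v = Var x) \/ occ_cmd 0 c = 1 ->
    lroot_cmd (Cut (Val v) (MuT c)) (subst_cmd (v .: Var) CVar c).

(** Compatible closure of a relation on terms and a relation on commands. *)
Inductive cc (R : relation tm) (Rc : relation cmd) : tm -> tm -> Prop :=
| cc_root t t' : R t t' -> cc R Rc t t'
| cc_Val v v' : cc_val R Rc v v' -> cc R Rc (Val v) (Val v')
| cc_Mu c c' : cc_cmd R Rc c c' -> cc R Rc (Mu c) (Mu c')
with cc_val (R : relation tm) (Rc : relation cmd) : val -> val -> Prop :=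
| cc_Lam t t' : cc R Rc t t' -> cc_val R Rc (Lam t) (Lam t')
with cc_cmd (R : relation tm) (Rc : relation cmd) : cmd -> cmd -> Prop :=
| cc_cmd_root c c' : Rc c c' -> cc_cmd R Rc c c'
| cc_Cut_l t t' e : cc R Rc t t' -> cc_cmd R Rc (Cut t e) (Cut t' e)
| cc_Cut_r t e e' : cc_ctx R Rc e e' -> cc_cmd R Rc (Cut t e) (Cut t e')
with cc_ctx (R : relation tm) (Rc : relation cmd) : ctx -> ctx -> Prop :=
| cc_Stk_l v v' e : cc_val R Rc v v' -> cc_ctx R Rc (Stk v e) (Stk v' e)
| cc_Stk_r v e e' : cc_ctx R Rc e e' -> cc_ctx R Rc (Stk v e) (Stk v e')
| cc_MuT c c' : cc_cmd R Rc c c' -> cc_ctx R Rc (MuT c) (MuT c').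

Definition step : relation tm := cc root root_cmd.
Definition step_cmd : relation cmd := cc_cmd root root_cmd.

(** Linear steps; every theta-step is linear. *)
Definition lstep : relation tm := cc root lroot_cmd.
Definition lstep_cmd : relation cmd := cc_cmd root lroot_cmd.

Definition red : relation tm := clos_refl_trans tm step.
Definition red_cmd : relation cmd := clos_refl_trans cmd step_cmd.
Definition lred : relation tm := clos_refl_trans tm lstep.
Definition lred_cmd : relation cmd := clos_refl_trans cmd lstep_cmd.

End LQ.

(** In the clause for [App], [w] is placed under the new mu-binder and [u]
    under the new mu- and mu-tilde-binders, whence the shifts. *)
Fixpoint dag (t : LM.tm) : LQ.tm :=
  match t with
  | LM.Var x => LQ.Val (LQ.Var x)
  | LM.Lam u => LQ.Val (LQ.Lam (dag u))
  | LM.App u w =>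
      LQ.Mu (LQ.Cut (LQ.ren idr S (dag w))
               (LQ.MuT (LQ.Cut (LQ.ren S S (dag u))
                          (LQ.Stk (LQ.Var 0) (LQ.CVar 0)))))
  | LM.Mu c => LQ.Mu (dag_cmd c)
  end
with dag_cmd (c : LM.cmd) : LQ.cmd :=
  match c with
  | LM.Name a t => LQ.Cut (dag t) (LQ.CVar a)
  end.

(* Main.v *)
Require Import Defs.
From Stdlib Require Import Relations.

(** When the contracted redex is not a [theta]-redex, the source rule replaces
    it by a body in which some substitution is performed.  The common reduct is
    then obtained by translating the body first and performing the translated
    substitution in the target calculus.

    From the translated redex this expression is reached directly: the cut that
    encodes an application passes the argument to the function, and a single
    [mu]-step or [mu-tilde]-step performs the substitution ([sim_beta],
    [sim_mu], [sim_mu']; [rho] is a [mu]-step as it stands).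

    From the translated reduct it is reached linearly.  The translation does
    not commute with structural substitution: replacing [a] by [v . a] in
    [[a] t] creates the application [[a] (t) v], translated as a cut between an
    application and [a], whereas the same replacement in the translation of
    [[a] t] gives [< t | v . a >].  The former reduces to the latter by a
    [mu]-step and a [mu-tilde]-step, and for [a(u)] in place of [v . a] by the
    [mu]-step alone ([dag_fill]).  Both steps are linear, because each of the
    two variables that the translation of an application introduces occurs
    once.  Hence translating after a substitution reduces linearly to
    substituting after the translation ([dag_subst]).

    A [theta]-redex translates to a [theta]-redex, and steps inside a term
    follow by congruence.  The translation of an application shifts its two
    subterms under binders, so congruence rests on the stability of reduction
    under renaming ([cc_ren]). *)

(** * Renaming and substitution in the target calculus *)

Section Syntax.
Import LQ.

Lemma upr_upr f1 f2 f :
  (forall x, f2 (f1 x) = f x) -> forall x, upr f2 (upr f1 x) = upr f x.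
Proof. intros H [|x]; simpl; congruence. Qed.

Local Hint Resolve upr_upr : core.

Lemma ren_ren t : forall f1 g1 f2 g2 f g,
  (forall x, f2 (f1 x) = f x) -> (forall a, g2 (g1 a) = g a) ->
  ren f2 g2 (ren f1 g1 t) = ren f g t
with ren_ren_val v : forall f1 g1 f2 g2 f g,
  (forall x, f2 (f1 x) = f x) -> (forall a, g2 (g1 a) = g a) ->
  ren_val f2 g2 (ren_val f1 g1 v) = ren_val f g v
with ren_ren_cmd c : forall f1 g1 f2 g2 f g,
  (forall x, f2 (f1 x) = f x) -> (forall a, g2 (g1 a) = g a) ->
  ren_cmd f2 g2 (ren_cmd f1 g1 c) = ren_cmd f g c
with ren_ren_ctx e : forall f1 g1 f2 g2 f g,
  (forall x, f2 (f1 x) = f x) -> (forall a, g2 (g1 a) = g a) ->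
  ren_ctx f2 g2 (ren_ctx f1 g1 e) = ren_ctx f g e.
Proof.
  - destruct t; intros; simpl; f_equal; auto.
  - destruct v; intros; simpl; f_equal; auto.
  - destruct c; intros; simpl; f_equal; auto.
  - destruct e; intros; simpl; f_equal; auto.
Qed.

Lemma ren_comm f1 g1 f2 g2 f1' g1' f2' g2' t :
  (forall x, f2 (f1 x) = f2' (f1' x)) -> (forall a, g2 (g1 a) = g2' (g1' a)) ->
  ren f2 g2 (ren f1 g1 t) = ren f2' g2' (ren f1' g1' t).
Proof.
  intros. erewrite (ren_ren t f1' g1') by reflexivity. now apply ren_ren.
Qed.

Lemma ren_comm_val f1 g1 f2 g2 f1' g1' f2' g2' v :
  (forall x, f2 (f1 x) = f2' (f1' x)) -> (forall a, g2 (g1 a) = g2' (g1' a)) ->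
  ren_val f2 g2 (ren_val f1 g1 v) = ren_val f2' g2' (ren_val f1' g1' v).
Proof.
  intros. erewrite (ren_ren_val v f1' g1') by reflexivity.
  now apply ren_ren_val.
Qed.

Lemma ren_comm_ctx f1 g1 f2 g2 f1' g1' f2' g2' e :
  (forall x, f2 (f1 x) = f2' (f1' x)) -> (forall a, g2 (g1 a) = g2' (g1' a)) ->
  ren_ctx f2 g2 (ren_ctx f1 g1 e) = ren_ctx f2' g2' (ren_ctx f1' g1' e).
Proof.
  intros. erewrite (ren_ren_ctx e f1' g1') by reflexivity.
  now apply ren_ren_ctx.
Qed.

Lemma upr_id f : (forall x, f x = x) -> forall x, upr f x = x.
Proof. intros H [|x]; simpl; congruence. Qed.

Local Hint Resolve upr_id : core.

Lemma ren_id t : forall f g,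
  (forall x, f x = x) -> (forall a, g a = a) -> ren f g t = t
with ren_id_val v : forall f g,
  (forall x, f x = x) -> (forall a, g a = a) -> ren_val f g v = v
with ren_id_cmd c : forall f g,
  (forall x, f x = x) -> (forall a, g a = a) -> ren_cmd f g c = c
with ren_id_ctx e : forall f g,
  (forall x, f x = x) -> (forall a, g a = a) -> ren_ctx f g e = e.
Proof.
  - destruct t; intros; simpl; f_equal; auto.
  - destruct v; intros; simpl; f_equal; auto.
  - destruct c; intros; simpl; f_equal; auto.
  - destruct e; intros; simpl; f_equal; auto.
Qed.

Lemma subst_ren t : forall f g s k s' k',
  (forall x, s (f x) = s' x) -> (forall a, k (g a) = k' a) ->
  subst s k (ren f g t) = subst s' k' t
with subst_ren_val v : forall f g s k s' k',
  (forall x, s (f x) = s' x) -> (forall a, k (g a) = k' a) ->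
  subst_val s k (ren_val f g v) = subst_val s' k' v
with subst_ren_cmd c : forall f g s k s' k',
  (forall x, s (f x) = s' x) -> (forall a, k (g a) = k' a) ->
  subst_cmd s k (ren_cmd f g c) = subst_cmd s' k' c
with subst_ren_ctx e : forall f g s k s' k',
  (forall x, s (f x) = s' x) -> (forall a, k (g a) = k' a) ->
  subst_ctx s k (ren_ctx f g e) = subst_ctx s' k' e.
Proof.
  - destruct t; intros; simpl; auto; f_equal; auto.
    apply subst_ren_cmd; [|intros [|a]]; simpl; congruence.
  - destruct v; intros; simpl; auto; f_equal; auto.
    apply subst_ren; [intros [|x]|]; simpl; congruence.
  - destruct c; intros; simpl; auto; f_equal; auto.
  - destruct e; intros; simpl; auto; f_equal; auto.
    apply subst_ren_cmd; [intros [|x]|]; simpl; congruence.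
Qed.

Lemma ren_up_val f g s s' :
  (forall x, ren_val f g (s x) = s' x) ->
  forall x, ren_val (upr f) g (up_val s x) = up_val s' x.
Proof.
  intros H [|x]; simpl; trivial. rewrite <- H. now apply ren_comm_val.
Qed.

Lemma ren_subst t : forall f g s k s' k',
  (forall x, ren_val f g (s x) = s' x) -> (forall a, ren_ctx f g (k a) = k' a) ->
  ren f g (subst s k t) = subst s' k' t
with ren_subst_val v : forall f g s k s' k',
  (forall x, ren_val f g (s x) = s' x) -> (forall a, ren_ctx f g (k a) = k' a) ->
  ren_val f g (subst_val s k v) = subst_val s' k' v
with ren_subst_cmd c : forall f g s k s' k',
  (forall x, ren_val f g (s x) = s' x) -> (forall a, ren_ctx f g (k a) = k' a) ->
  ren_cmd f g (subst_cmd s k c) = subst_cmd s' k' c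
with ren_subst_ctx e : forall f g s k s' k',
  (forall x, ren_val f g (s x) = s' x) -> (forall a, ren_ctx f g (k a) = k' a) ->
  ren_ctx f g (subst_ctx s k e) = subst_ctx s' k' e.
Proof.
  - destruct t; intros f g s k s' k' Hs Hk; simpl; auto; f_equal; auto.
    apply ren_subst_cmd; [intros x|intros [|a]]; simpl; trivial.
    + rewrite <- Hs. now apply ren_comm_val.
    + rewrite <- Hk. now apply ren_comm_ctx.
  - destruct v; intros f g s k s' k' Hs Hk; simpl; auto; f_equal; auto.
    apply ren_subst; [now apply ren_up_val|intros a].
    rewrite <- Hk. now apply ren_comm_ctx.
  - destruct c; intros; simpl; auto; f_equal; auto.
  - destruct e; intros f g s k s' k' Hs Hk; simpl; auto; f_equal; auto.
    apply ren_subst_cmd; [now apply ren_up_val|intros a].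
    rewrite <- Hk. now apply ren_comm_ctx.
Qed.

Lemma subst_var t : forall f g s k,
  (forall x, s x = Var (f x)) -> (forall a, k a = CVar (g a)) ->
  subst s k t = ren f g t
with subst_var_val v : forall f g s k,
  (forall x, s x = Var (f x)) -> (forall a, k a = CVar (g a)) ->
  subst_val s k v = ren_val f g v
with subst_var_cmd c : forall f g s k,
  (forall x, s x = Var (f x)) -> (forall a, k a = CVar (g a)) ->
  subst_cmd s k c = ren_cmd f g c
with subst_var_ctx e : forall f g s k,
  (forall x, s x = Var (f x)) -> (forall a, k a = CVar (g a)) ->
  subst_ctx s k e = ren_ctx f g e.
Proof.
  - destruct t; intros f g s k Hs Hk; simpl; f_equal; auto.
    apply subst_var_cmd; [intros x|intros [|a]]; simpl; trivial;
      [now rewrite Hs|now rewrite Hk].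
  - destruct v; intros f g s k Hs Hk; simpl; auto. f_equal.
    apply subst_var; [intros [|x]|intros a]; simpl; trivial;
      [now rewrite Hs|now rewrite Hk].
  - destruct c; intros; simpl; f_equal; auto.
  - destruct e; intros f g s k Hs Hk; simpl; auto; f_equal; auto.
    apply subst_var_cmd; [intros [|x]|intros a]; simpl; trivial;
      [now rewrite Hs|now rewrite Hk].
Qed.

Lemma subst_ren_var t f g s k f' g' :
  (forall x, s (f x) = Var (f' x)) -> (forall a, k (g a) = CVar (g' a)) ->
  subst s k (ren f g t) = ren f' g' t.
Proof.
  intros. erewrite subst_ren by reflexivity. now apply subst_var.
Qed.

Lemma subst_ren_id t f g s k :
  (forall x, s (f x) = Var x) -> (forall a, k (g a) = CVar a) ->
  subst s k (ren f g t) = t.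
Proof.
  intros. erewrite subst_ren_var with (f' := idr) (g' := idr) by assumption.
  now apply ren_id.
Qed.

Lemma subst_ren_id_ctx e f g s k :
  (forall x, s (f x) = Var x) -> (forall a, k (g a) = CVar a) ->
  subst_ctx s k (ren_ctx f g e) = e.
Proof.
  intros. erewrite subst_ren_ctx by reflexivity.
  erewrite subst_var_ctx with (f := idr) (g := idr) by assumption.
  now apply ren_id_ctx.
Qed.

(** * Occurrences under renaming *)

(** The hypothesis makes [x'] the only preimage of [x].  As an equation between
    boolean tests it passes under a binder by computation. *)
Lemma occ_ren t : forall x x' f g,
  (forall y, Nat.eqb x (f y) = Nat.eqb x' y) -> occ x (ren f g t) = occ x' t
with occ_ren_val v : forall x x' f g,
  (forall y, Nat.eqb x (f y) = Nat.eqb x' y) ->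
  occ_val x (ren_val f g v) = occ_val x' v
with occ_ren_cmd c : forall x x' f g,
  (forall y, Nat.eqb x (f y) = Nat.eqb x' y) ->
  occ_cmd x (ren_cmd f g c) = occ_cmd x' c
with occ_ren_ctx e : forall x x' f g,
  (forall y, Nat.eqb x (f y) = Nat.eqb x' y) ->
  occ_ctx x (ren_ctx f g e) = occ_ctx x' e.
Proof.
  - destruct t; intros; simpl; auto.
  - destruct v as [y|t]; intros x x' f g H; simpl; [now rewrite H|].
    apply occ_ren. intros [|y]; simpl; auto.
  - destruct c; intros; simpl; auto.
  - destruct e as [a|v e|c]; intros x x' f g H; simpl; auto.
    apply occ_ren_cmd. intros [|y]; simpl; auto.
Qed.

Lemma mocc_ren t : forall a a' f g,
  (forall b, Nat.eqb a (g b) = Nat.eqb a' b) -> mocc a (ren f g t) = mocc a' t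
with mocc_ren_val v : forall a a' f g,
  (forall b, Nat.eqb a (g b) = Nat.eqb a' b) ->
  mocc_val a (ren_val f g v) = mocc_val a' v
with mocc_ren_cmd c : forall a a' f g,
  (forall b, Nat.eqb a (g b) = Nat.eqb a' b) ->
  mocc_cmd a (ren_cmd f g c) = mocc_cmd a' c
with mocc_ren_ctx e : forall a a' f g,
  (forall b, Nat.eqb a (g b) = Nat.eqb a' b) ->
  mocc_ctx a (ren_ctx f g e) = mocc_ctx a' e.
Proof.
  - destruct t as [v|c]; intros a a' f g H; simpl; auto.
    apply mocc_ren_cmd. intros [|b]; simpl; auto.
  - destruct v; intros; simpl; auto.
  - destruct c; intros; simpl; auto.
  - destruct e as [b|v e|c]; intros a a' f g H; simpl; auto. now rewrite H.
Qed.

Lemma occ_ren_fresh t : forall x f g,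
  (forall y, Nat.eqb x (f y) = false) -> occ x (ren f g t) = 0
with occ_ren_fresh_val v : forall x f g,
  (forall y, Nat.eqb x (f y) = false) -> occ_val x (ren_val f g v) = 0
with occ_ren_fresh_cmd c : forall x f g,
  (forall y, Nat.eqb x (f y) = false) -> occ_cmd x (ren_cmd f g c) = 0
with occ_ren_fresh_ctx e : forall x f g,
  (forall y, Nat.eqb x (f y) = false) -> occ_ctx x (ren_ctx f g e) = 0.
Proof.
  - destruct t; intros; simpl; auto.
  - destruct v as [y|t]; intros x f g H; simpl; [now rewrite H|].
    apply occ_ren_fresh. intros [|y]; simpl; auto.
  - destruct c as [t e]; intros x f g H; simpl.
    now rewrite occ_ren_fresh, occ_ren_fresh_ctx.
  - destruct e as [a|v e|c]; intros x f g H; simpl; trivial.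
    + now rewrite occ_ren_fresh_val, occ_ren_fresh_ctx.
    + apply occ_ren_fresh_cmd. intros [|y]; simpl; auto.
Qed.

Lemma mocc_ren_fresh t : forall a f g,
  (forall b, Nat.eqb a (g b) = false) -> mocc a (ren f g t) = 0
with mocc_ren_fresh_val v : forall a f g,
  (forall b, Nat.eqb a (g b) = false) -> mocc_val a (ren_val f g v) = 0
with mocc_ren_fresh_cmd c : forall a f g,
  (forall b, Nat.eqb a (g b) = false) -> mocc_cmd a (ren_cmd f g c) = 0
with mocc_ren_fresh_ctx e : forall a f g,
  (forall b, Nat.eqb a (g b) = false) -> mocc_ctx a (ren_ctx f g e) = 0.
Proof.
  - destruct t as [v|c]; intros a f g H; simpl; auto.
    apply mocc_ren_fresh_cmd. intros [|b]; simpl; auto.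
  - destruct v; intros; simpl; auto.
  - destruct c as [t e]; intros a f g H; simpl.
    now rewrite mocc_ren_fresh, mocc_ren_fresh_ctx.
  - destruct e as [b|v e|c]; intros a f g H; simpl; auto.
    + now rewrite H.
    + now rewrite mocc_ren_fresh_val, mocc_ren_fresh_ctx.
Qed.

(** * Stability of reduction under renaming *)

Scheme cc_mut := Minimality for cc Sort Prop
with cc_val_mut := Minimality for cc_val Sort Prop
with cc_cmd_mut := Minimality for cc_cmd Sort Prop
with cc_ctx_mut := Minimality for cc_ctx Sort Prop.

Definition ren_stable (R : relation tm) : Prop :=
  forall f g t t', R t t' -> R (ren f g t) (ren f g t').

Definition ren_stable_cmd (Rc : relation cmd) : Prop :=
  forall f g c c', Rc c c' -> Rc (ren_cmd f g c) (ren_cmd f g c').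

Lemma cc_ren R Rc :
  ren_stable R -> ren_stable_cmd Rc -> ren_stable (cc R Rc).
Proof.
  intros HR HRc f g t t' H. revert f g. pattern t, t'.
  revert t t' H.
  apply (cc_mut R Rc _
    (fun v v' => forall f g, cc_val R Rc (ren_val f g v) (ren_val f g v'))
    (fun c c' => forall f g, cc_cmd R Rc (ren_cmd f g c) (ren_cmd f g c'))
    (fun e e' => forall f g, cc_ctx R Rc (ren_ctx f g e) (ren_ctx f g e')));
    intros; simpl; auto using cc, cc_val, cc_cmd, cc_ctx.
Qed.

Lemma root_ren : ren_stable root.
Proof.
  intros f g _ _ [t]. simpl.
  rewrite (ren_comm idr S f (upr g) f g idr S) by reflexivity. constructor.
Qed.

Lemma ren_subst_cmd_mu f g e c :
  ren_cmd f g (subst_cmd Var (e .: CVar) c) =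
  subst_cmd Var (ren_ctx f g e .: CVar) (ren_cmd f (upr g) c).
Proof.
  erewrite (subst_ren_cmd c) by reflexivity.
  apply ren_subst_cmd; [|intros [|a]]; reflexivity.
Qed.

Lemma ren_subst_cmd_mut f g v c :
  ren_cmd f g (subst_cmd (v .: Var) CVar c) =
  subst_cmd (ren_val f g v .: Var) CVar (ren_cmd (upr f) g c).
Proof.
  erewrite (subst_ren_cmd c) by reflexivity.
  apply ren_subst_cmd; [intros [|x]|]; reflexivity.
Qed.

Lemma root_cmd_ren : ren_stable_cmd root_cmd.
Proof.
  intros f g _ _ [u v e|c e|v c]; simpl.
  - rewrite (ren_comm_ctx S idr (upr f) g f g S idr) by reflexivity.
    constructor.
  - rewrite ren_subst_cmd_mu. constructor.
  - rewrite ren_subst_cmd_mut. constructor.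
Qed.

(** Linearity survives because lifted renamings neither create nor merge
    occurrences of the bound variable, and a renamed variable is a variable. *)
Lemma lroot_cmd_ren : ren_stable_cmd lroot_cmd.
Proof.
  intros f g _ _ [u v e|c e H|v c H]; simpl.
  - rewrite (ren_comm_ctx S idr (upr f) g f g S idr) by reflexivity.
    constructor.
  - rewrite ren_subst_cmd_mu. constructor. destruct H as [[a ->]|H].
    + left. now exists (g a).
    + right. rewrite <- H. apply mocc_ren_cmd. intros [|b]; simpl; auto.
  - rewrite ren_subst_cmd_mut. constructor. destruct H as [[x ->]|H].
    + left. now exists (f x).
    + right. rewrite <- H. apply occ_ren_cmd. intros [|y]; simpl; auto.
Qed.

End Syntax.

(** * Congruence of iterated reduction *)

Lemma clos_map {A B : Type} (R : relation A) (R' : relation B) (h : A -> B) :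
  (forall x y, R x y -> R' (h x) (h y)) ->
  forall x y, clos_refl_trans A R x y -> clos_refl_trans B R' (h x) (h y).
Proof.
  intros H x y. induction 1; eauto using clos_refl_trans.
Qed.

(** Naming the image of an application lets renaming, substitution and
    reduction be shown to act on it argument by argument. *)
Definition app (t u : LQ.tm) : LQ.tm :=
  LQ.Mu (LQ.Cut (LQ.ren idr S u)
          (LQ.MuT (LQ.Cut (LQ.ren S S t) (LQ.Stk (LQ.Var 0) (LQ.CVar 0))))).

Section Congruence.
Context (R : relation LQ.tm) (Rc : relation LQ.cmd).
Hypotheses (HR : ren_stable R) (HRc : ren_stable_cmd Rc).

Let Red := clos_refl_trans _ (LQ.cc R Rc).
Let Red_cmd := clos_refl_trans _ (LQ.cc_cmd R Rc).

Lemma Red_Lam t t' :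
  Red t t' -> Red (LQ.Val (LQ.Lam t)) (LQ.Val (LQ.Lam t')).
Proof.
  apply (clos_map _ _ (fun t => LQ.Val (LQ.Lam t))).
  auto using LQ.cc, LQ.cc_val.
Qed.

Lemma Red_Mu c c' : Red_cmd c c' -> Red (LQ.Mu c) (LQ.Mu c').
Proof. apply clos_map. auto using LQ.cc. Qed.

Lemma Red_Cut_l t t' e : Red t t' -> Red_cmd (LQ.Cut t e) (LQ.Cut t' e).
Proof.
  apply (clos_map _ _ (fun t => LQ.Cut t e)). auto using LQ.cc_cmd.
Qed.

Lemma Red_app_l t t' u : Red t t' -> Red (app t u) (app t' u).
Proof.
  apply (clos_map _ _ (fun t => app t u)). intros.
  apply LQ.cc_Mu, LQ.cc_Cut_r, LQ.cc_MuT, LQ.cc_Cut_l. now apply cc_ren.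
Qed.

Lemma Red_app_r t u u' : Red u u' -> Red (app t u) (app t u').
Proof.
  apply (clos_map _ _ (app t)). intros.
  apply LQ.cc_Mu, LQ.cc_Cut_l. now apply cc_ren.
Qed.

End Congruence.

(** * The translation and substitution *)

Scheme lm_tm_mut := Induction for LM.tm Sort Prop
with lm_cmd_mut := Induction for LM.cmd Sort Prop.

Lemma ren_app f g t u : LQ.ren f g (app t u) = app (LQ.ren f g t) (LQ.ren f g u).
Proof.
  unfold app; simpl.
  now rewrite (ren_comm idr S f (upr g) f g idr S),
    (ren_comm S S (upr f) (upr g) f g S S).
Qed.

Lemma subst_app s k t u :
  LQ.subst s k (app t u) = app (LQ.subst s k t) (LQ.subst s k u).
Proof.
  unfold app; simpl. do 2 f_equal; [|do 2 f_equal].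
  - erewrite subst_ren by reflexivity. symmetry. now apply ren_subst.
  - erewrite subst_ren by reflexivity. symmetry.
    apply ren_subst; intros; symmetry;
      [apply ren_ren_val|apply ren_ren_ctx]; reflexivity.
Qed.

Lemma dag_ren t : forall f g, dag (LM.ren f g t) = LQ.ren f g (dag t)
with dag_ren_cmd c :
  forall f g, dag_cmd (LM.ren_cmd f g c) = LQ.ren_cmd f g (dag_cmd c).
Proof.
  - destruct t as [x|t|t u|c]; intros f g; simpl.
    + reflexivity.
    + now rewrite dag_ren.
    + rewrite !dag_ren. symmetry. apply ren_app.
    + now rewrite dag_ren_cmd.
  - destruct c as [a t]; intros f g; simpl. now rewrite dag_ren.
Qed.

(** The context of the target calculus that a context of the source calculus
    stands for.  An argument has to translate to a value, since stacks of the
    target calculus only hold values; this is why the relation is partial. *)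
Inductive ctx_dag : LM.ctx -> LQ.ctx -> Prop :=
| ctx_dag_var a : ctx_dag (LM.CVar a) (LQ.CVar a)
| ctx_dag_fun b t :
    ctx_dag (LM.CFun b t)
      (LQ.MuT (LQ.Cut (LQ.ren S idr (dag t)) (LQ.Stk (LQ.Var 0) (LQ.CVar b))))
| ctx_dag_arg t v e e' :
    dag t = LQ.Val v -> ctx_dag e e' -> ctx_dag (LM.CArg t e) (LQ.Stk v e').

Lemma ctx_dag_ren f g e e' :
  ctx_dag e e' -> ctx_dag (LM.ren_ctx f g e) (LQ.ren_ctx f g e').
Proof.
  induction 1 as [a|b t|t v e e' Hv He IH]; simpl.
  - constructor.
  - rewrite (ren_comm S idr (upr f) g f g S idr), <- dag_ren by reflexivity.
    constructor.
  - constructor; trivial. now rewrite dag_ren, Hv.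
Qed.

(** The mu-variable introduced for an application occurs only at the bottom of
    its stack: firing the binder moves [e] there and undoes the shifts. *)
Lemma subst_app_mu t u e :
  LQ.subst_cmd LQ.Var (e .: LQ.CVar)
    (LQ.Cut (LQ.ren idr S u)
       (LQ.MuT (LQ.Cut (LQ.ren S S t) (LQ.Stk (LQ.Var 0) (LQ.CVar 0))))) =
  LQ.Cut u (LQ.MuT (LQ.Cut (LQ.ren S idr t)
                      (LQ.Stk (LQ.Var 0) (LQ.ren_ctx S idr e)))).
Proof.
  simpl. rewrite subst_ren_id by reflexivity.
  erewrite subst_ren_var by reflexivity. reflexivity.
Qed.

Lemma subst_app_mut t v e :
  LQ.subst_cmd (v .: LQ.Var) LQ.CVar
    (LQ.Cut (LQ.ren S idr t) (LQ.Stk (LQ.Var 0) (LQ.ren_ctx S idr e))) =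
  LQ.Cut t (LQ.Stk v e).
Proof.
  simpl. now rewrite subst_ren_id, subst_ren_id_ctx.
Qed.

Lemma app_mu_lstep t u e :
  LQ.lstep_cmd (LQ.Cut (app t u) e)
    (LQ.Cut u (LQ.MuT (LQ.Cut (LQ.ren S idr t)
                         (LQ.Stk (LQ.Var 0) (LQ.ren_ctx S idr e))))).
Proof.
  rewrite <- subst_app_mu. apply LQ.cc_cmd_root. constructor. right. simpl.
  now rewrite !mocc_ren_fresh.
Qed.

Lemma app_mut_lstep t v e :
  LQ.lstep_cmd
    (LQ.Cut (LQ.Val v) (LQ.MuT (LQ.Cut (LQ.ren S idr t)
                                  (LQ.Stk (LQ.Var 0) (LQ.ren_ctx S idr e)))))
    (LQ.Cut t (LQ.Stk v e)).
Proof.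
  rewrite <- (subst_app_mut t v e). apply LQ.cc_cmd_root. constructor. right. simpl.
  now rewrite occ_ren_fresh, occ_ren_fresh_ctx.
Qed.

(** Filling a context creates applications, whose administrative redexes
    unwind linearly to a cut against the translated context. *)
Lemma dag_fill e e' :
  ctx_dag e e' ->
  forall t, LQ.lred_cmd (dag_cmd (LM.fill e t)) (LQ.Cut (dag t) e').
Proof.
  induction 1 as [a|b u|u v e e' Hv He IH]; intros t; simpl.
  - apply rt_refl.
  - apply rt_step. apply (app_mu_lstep (dag u) (dag t) (LQ.CVar b)).
  - eapply rt_trans; [apply IH|]. simpl.
    eapply rt_trans; apply rt_step.
    + apply (app_mu_lstep (dag t) (dag u)).
    + rewrite Hv. apply app_mut_lstep.
Qed.

(** Substituting a stack [v . e] for a mu-variable before translating leaves an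
    application at each occurrence, where substituting after translating leaves
    the stack itself; hence a linear reduction and not an equality. *)
Lemma dag_subst t : forall s k s' k',
  (forall x, dag (s x) = LQ.Val (s' x)) -> (forall a, ctx_dag (k a) (k' a)) ->
  LQ.lred (dag (LM.subst s k t)) (LQ.subst s' k' (dag t))
with dag_subst_cmd c : forall s k s' k',
  (forall x, dag (s x) = LQ.Val (s' x)) -> (forall a, ctx_dag (k a) (k' a)) ->
  LQ.lred_cmd (dag_cmd (LM.subst_cmd s k c)) (LQ.subst_cmd s' k' (dag_cmd c)).
Proof.
  - destruct t as [x|t|t u|c]; intros s k s' k' Hs Hk; simpl.
    + rewrite Hs. apply rt_refl.
    + apply Red_Lam, dag_subst.
      * intros [|x]; simpl; trivial. now rewrite dag_ren, Hs.
      * intros a. now apply ctx_dag_ren.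
    + change (LQ.lred
        (app (dag (LM.subst s k t)) (dag (LM.subst s k u)))
        (LQ.subst s' k' (app (dag t) (dag u)))).
      rewrite subst_app. eapply rt_trans.
      * apply Red_app_l, dag_subst; auto using root_ren, lroot_cmd_ren.
      * apply Red_app_r, dag_subst; auto using root_ren, lroot_cmd_ren.
    + apply Red_Mu, dag_subst_cmd.
      * intros x. now rewrite dag_ren, Hs.
      * intros [|a]; simpl; [constructor|now apply ctx_dag_ren].
  - destruct c as [a t]; intros s k s' k' Hs Hk; simpl.
    eapply rt_trans; [now apply dag_fill|].
    now apply Red_Cut_l, dag_subst.
Qed.

(** * Simulation of one step *)

Scheme lm_step_mut := Minimality for LM.step Sort Prop
with lm_step_cmd_mut := Minimality for LM.step_cmd Sort Prop.
Combined Scheme lm_step_comb from lm_step_mut, lm_step_cmd_mut.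

Lemma dag_value v : LM.value v -> exists v', dag v = LQ.Val v'.
Proof. destruct 1; simpl; eauto. Qed.

(** Under its binder, a translated application whose argument is a value has
    the shape treated by [subst_app_mut], with the bound mu-variable as [e]. *)
Lemma app_value_step t v :
  LQ.step (app t (LQ.Val v))
    (LQ.Mu (LQ.Cut (LQ.ren idr S t)
              (LQ.Stk (LQ.ren_val idr S v) (LQ.CVar 0)))).
Proof.
  unfold app. rewrite <- (ren_ren t idr S S idr) by reflexivity.
  apply LQ.cc_Mu, LQ.cc_cmd_root.
  rewrite <- (subst_app_mut _ (LQ.ren_val idr S v)).
  apply LQ.root_mut.
Qed.

Lemma sim_beta u v v' :
  dag v = LQ.Val v' ->
  LQ.red (dag (LM.App (LM.Lam u) v)) (LQ.subst (v' .: LQ.Var) LQ.CVar (dag u)).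
Proof.
  intros Hv. simpl. rewrite Hv.
  eapply rt_trans; [apply rt_step, (app_value_step (LQ.Val (LQ.Lam (dag u))))|]. simpl.
  eapply rt_trans; [apply rt_step, LQ.cc_Mu, LQ.cc_cmd_root, LQ.root_beta|].
  eapply rt_trans; [apply rt_step, LQ.cc_Mu, LQ.cc_cmd_root, LQ.root_mut|].
  simpl. apply rt_step, LQ.cc_root.
  (* the outer mu-variable is not free in the substituted body *)
  erewrite subst_ren by reflexivity.
  erewrite <- ren_subst with (f := idr) (g := S); [apply LQ.root_theta|..];
    intros [|x]; reflexivity.
Qed.

Lemma sim_mu c v v' :
  dag v = LQ.Val v' ->
  LQ.red (dag (LM.App (LM.Mu c) v))
    (LQ.Mu (LQ.subst_cmd LQ.Var
              (LQ.Stk (LQ.ren_val idr S v') (LQ.CVar 0)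
                 .: (fun a => LQ.CVar (S a))) (dag_cmd c))).
Proof.
  intros Hv. simpl. rewrite Hv.
  eapply rt_trans; [apply rt_step, (app_value_step (LQ.Mu (dag_cmd c)))|]. simpl.
  erewrite <- subst_ren_cmd with (f := idr) (g := upr S);
    [apply rt_step, LQ.cc_Mu, LQ.cc_cmd_root, LQ.root_mu|..];
    intros [|x]; reflexivity.
Qed.

Lemma sim_mu' t c :
  LQ.red (dag (LM.App t (LM.Mu c)))
    (LQ.Mu (LQ.subst_cmd LQ.Var
              (LQ.MuT (LQ.Cut (LQ.ren S idr (dag (LM.ren idr S t)))
                         (LQ.Stk (LQ.Var 0) (LQ.CVar 0)))
                 .: (fun a => LQ.CVar (S a))) (dag_cmd c))).
Proof.
  simpl. rewrite dag_ren.
  rewrite (ren_ren (dag t) idr S S idr S S) by reflexivity.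
  erewrite <- subst_ren_cmd with (f := idr) (g := upr S);
    [apply rt_step, LQ.cc_Mu, LQ.cc_cmd_root, LQ.root_mu|..];
    intros [|x]; reflexivity.
Qed.

Theorem corollary2 :
  (forall t t' : LM.tm, LM.step t t' ->
     exists u : LQ.tm, LQ.red (dag t) u /\ LQ.lred (dag t') u) /\
  (forall c c' : LM.cmd, LM.step_cmd c c' ->
     exists u : LQ.cmd, LQ.red_cmd (dag_cmd c) u /\ LQ.lred_cmd (dag_cmd c') u).
Proof.
  apply lm_step_comb.
  - intros u v Hv. destruct (dag_value v Hv) as [v' Hv'].
    eexists. split; [apply (sim_beta _ _ _ Hv')|].
    apply dag_subst; [intros [|x]|constructor]; trivial.
  - intros c v Hv. destruct (dag_value v Hv) as [v' Hv'].
    eexists. split; [apply (sim_mu _ _ _ Hv')|].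
    apply Red_Mu, dag_subst_cmd; trivial.
    intros [|a]; repeat constructor. now rewrite dag_ren, Hv'.
  - intros t c. eexists. split; [apply sim_mu'|].
    apply Red_Mu, dag_subst_cmd; trivial.
    intros [|a]; constructor.
  - intros t. exists (dag t). split; [|apply rt_refl]. simpl.
    rewrite dag_ren. apply rt_step, LQ.cc_root, LQ.root_theta.
  - intros t t' _ (u & H & H'). eexists.
    split; apply Red_Lam; eassumption.
  - intros t t' u _ (w & H & H'). exists (app w (dag u)).
    split; apply Red_app_l; auto using root_ren, root_cmd_ren, lroot_cmd_ren.
  - intros t u u' _ (w & H & H'). exists (app (dag t) w).
    split; apply Red_app_r; auto using root_ren, root_cmd_ren, lroot_cmd_ren.
  - intros c c' _ (w & H & H'). eexists. split; apply Red_Mu; eassumption.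
  - intros b c. eexists. split.
    + apply rt_step, LQ.cc_cmd_root, LQ.root_mu.
    + apply dag_subst_cmd; trivial. intros [|a]; constructor.
  - intros a t t' _ (w & H & H'). eexists.
    split; apply Red_Cut_l; eassumption.
Qed.
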